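(* There is a constant $c$ such that for every $n$, every deterministic two-party communication protocol $P$ (without help bits) that computes the inner product function $f(x,y)=\sum_{i=1}^n x_i y_i \bmod 2$ correctly on all inputs $x=x_1\dots x_n,\ y=y_1\dots y_n\in\{0,1\}^n$ (with Alice outputting the value), and all $x,y\in\{0,1\}^n$, we have $$CC^P(x,y)\ \ge\ C(x,y\mid P)-n-c.$$
   Context: $C(\cdot\mid\cdot)$ denotes plain (conditional) Kolmogorov complexity with respect to a fixed reference universal Turing machine; $C(x,y\mid P)$ is the complexity of (an encoding of) the pair $(x,y)$ given a description of the protocol $P$. Protocols are deterministic two-party communication protocols in the standard (Yao) sense: Alice holds $x$, Bob holds $y$, they exchange bits according to $P$, and at the end Alice outputs a value. The protocol knows the input length $n$. $CC^P(x,y)$ is the number of bits exchanged between Alice and Bob when running $P$ on input $(x,y)$. *)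

(* Defs.v *)
From mathcomp Require Import all_boot.
From mathcomp Require Import boolp.

Set Implicit Arguments.
Unset Strict Implicit.
Unset Printing Implicit Defensive.

Definition bits := seq bool.

(** * Deterministic multi-tape Turing machines over the tape alphabet {0, 1, blank} *)

Definition symbol := option bool. (* [None] is the blank *)

(* A two-way infinite tape: every cell beyond the two lists is blank, and
   [left_of] is listed starting from the cell next to the head. *)
Record tape : Type := Tape { left_of : seq symbol; scanned : symbol; right_of : seq symbol }.

Inductive move : Type := MoveLeft | Stay | MoveRight.

Definition tape_of (s : bits) : tape :=
  Tape [::] (head None (map Some s)) (behead (map Some s)).

Definition write_move (a : symbol * move) (t : tape) : tape :=
  match a.2 with
  | MoveLeft => Tape (behead (left_of t)) (head None (left_of t)) (a.1 :: right_of t)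
  | Stay => Tape (left_of t) a.1 (right_of t)
  | MoveRight => Tape (a.1 :: left_of t) (head None (right_of t)) (behead (right_of t))
  end.

Fixpoint bits_before_blank (s : seq symbol) : bits :=
  if s is Some b :: s' then b :: bits_before_blank s' else [::].

Definition tape_word (t : tape) : bits := bits_before_blank (scanned t :: right_of t).

(* There are [extra_tapes.+2] tapes: tape 0 (program and output), tape 1
   (condition) and work tapes. [delta q r = None] means that the machine halts. *)
Record machine : Type := Machine {
  state : finType;
  extra_tapes : nat;
  start : state;
  delta : state -> {ffun 'I_extra_tapes.+2 -> symbol} ->
          option (state * {ffun 'I_extra_tapes.+2 -> symbol * move})
}.

Record config (M : machine) : Type := Config {
  control : state M;
  tapes : {ffun 'I_(extra_tapes M).+2 -> tape}
}.

Definition init (M : machine) (p q : bits) : config M :=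
  Config (start M)
    [ffun i : 'I_(extra_tapes M).+2 =>
       tape_of (if i == 0 :> nat then p else if i == 1 :> nat then q else [::])].

Definition next (M : machine) (c : config M) :=
  delta (control c) [ffun i => scanned (tapes c i)].

Definition step (M : machine) (c : config M) : config M :=
  if next c is Some (s, a) then Config s [ffun i => write_move (a i) (tapes c i)] else c.

Definition halted (M : machine) (c : config M) : bool := ~~ next c.

(* The output is the word on tape 0 from the head up to the first blank. *)
Definition computes (M : machine) (p q z : bits) : Prop :=
  exists m, let c := iter m (@step M) (init M p q) in
    halted c /\ tape_word (tapes c ord0) = z.

(** * Plain conditional Kolmogorov complexity *)

(* [U] simulates every machine [M], once a code [w] of [M] is prefixed to the program. *)
Definition is_universal (U : machine) : Prop :=
  forall M : machine, exists w : bits,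
    forall p q z : bits, computes U (w ++ p) q z <-> computes M p q z.

Record universal_machine : Type := UniversalMachine {
  umachine :> machine;
  umachineP : is_universal umachine
}.

Definition has_program_of_size (U : machine) (z q : bits) : pred nat :=
  fun k => `[< exists p : bits, size p = k /\ computes U p q z >].

Lemma has_program (U : universal_machine) (z q : bits) :
  exists k, has_program_of_size U z q k.
Proof.
pose M := @Machine unit 0 tt (fun _ _ => None).
have [w wP] := umachineP U M.
exists (size (w ++ z)); apply/asboolP; exists (w ++ z); split=> //.
apply/wP; exists 0 => /=; split=> //.
by rewrite ffunE /tape_word; case: z => //= b z; congr cons; elim: z => //= ? ? ->.
Qed.

(* C(z | q) *)
Definition complexity (U : universal_machine) (z q : bits) : nat :=
  ex_minn (has_program U z q).

(* The self-delimiting pairing 1^|x| 0 x y. *)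
Definition pair_code (x y : bits) : bits := nseq (size x) true ++ false :: x ++ y.

(** * Two-party protocols on inputs of length [n] *)

(* Protocol trees. A message depends on the sender's input and on the node, i.e.
   on the bits sent so far; bit 0 leads to the first subtree, bit 1 to the second.
   The final value is computed by Alice from her input and the leaf, and is not
   communicated. *)
Inductive protocol (n : nat) : Type :=
| AliceOutputs (g : n.-tuple bool -> bool)
| AliceSends (a : n.-tuple bool -> bool) (P0 P1 : protocol n)
| BobSends (b : n.-tuple bool -> bool) (P0 P1 : protocol n).

Fixpoint output n (P : protocol n) (x y : n.-tuple bool) : bool :=
  match P with
  | AliceOutputs g => g x
  | AliceSends a P0 P1 => if a x then output P1 x y else output P0 x y
  | BobSends b P0 P1 => if b y then output P1 x y else output P0 x y
  end.

(* CC^P(x, y) *)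
Fixpoint comm_cost n (P : protocol n) (x y : n.-tuple bool) : nat :=
  match P with
  | AliceOutputs _ => 0
  | AliceSends a P0 P1 => (if a x then comm_cost P1 x y else comm_cost P0 x y).+1
  | BobSends b P0 P1 => (if b y then comm_cost P1 x y else comm_cost P0 x y).+1
  end.

Definition computes_inner_product n (P : protocol n) : Prop :=
  forall x y : n.-tuple bool,
    output P x y = (\sum_(i < n) tnth x i * tnth y i) %% 2 :> nat.

(* The values of [f] in lexicographic order of the argument. *)
Fixpoint truth_table n : (n.-tuple bool -> bool) -> bits :=
  match n with
  | 0 => fun f => [:: f [tuple]]
  | m.+1 => fun f => truth_table (fun t : m.-tuple bool => f (cons_tuple false t)) ++
                     truth_table (fun t : m.-tuple bool => f (cons_tuple true t))
  end.

Fixpoint tree_code n (P : protocol n) : bits :=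
  match P with
  | AliceOutputs g => false :: truth_table g
  | AliceSends a P0 P1 => [:: true, false & truth_table a ++ tree_code P0 ++ tree_code P1]
  | BobSends b P0 P1 => [:: true, true & truth_table b ++ tree_code P0 ++ tree_code P1]
  end.

(* The description of a protocol includes the input length. *)
Definition description n (P : protocol n) : bits := nseq n true ++ false :: tree_code P.

(* Main.v *)
(** Let [A] x [B] be the rectangle of the inputs that reach the same leaf as
    [(x, y)]. On it the inner product is the value Alice outputs, so it depends on the
    first argument only, and Parseval's identity for the characters
    [x |-> (-1) ^ <x, y>] gives [|A| |B| <= 2 ^ n]. Given [P], the pair [(x, y)] is
    thus determined by the transcript and an [n]-bit index into [A] x [B].

    That this description can be decoded by a fixed Turing machine is shown by
    compiling a small language of stack programs to multi-tape machines. The decoder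
    follows the transcript down the protocol tree while filtering two tables of
    [2 ^ n] bits that represent [A] and [B], and then enumerates the pairs in
    lexicographic order until the index overflows. *)

Require Import Defs.
From mathcomp Require Import all_boot.
From mathcomp Require Import all_order ssralg ssrnum ssrint zify.
From mathcomp Require Import boolp.

Set Implicit Arguments.
Unset Strict Implicit.
Unset Printing Implicit Defensive.

(** * Stack programs and their compilation *)

Section StackPrograms.

Variable extra : nat.
Local Notation K := extra.+2.

Inductive cmd : Type :=
| Nop
| Push (i : 'I_K) (b : bool)
| Seq (c1 c2 : cmd)
| Match (i : 'I_K) (ce c0 c1 : cmd)
| Loop (i : 'I_K) (c0 c1 : cmd).

Implicit Types (c : cmd) (s : seq bits) (i : 'I_K).

Definition put s i (v : bits) : seq bits := set_nth [::] s i v.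

Inductive exec : cmd -> seq bits -> seq bits -> Prop :=
| ExecNop s : exec Nop s s
| ExecPush i b s : exec (Push i b) s (put s i (b :: nth [::] s i))
| ExecSeq c1 c2 s1 s2 s3 :
    exec c1 s1 s2 -> exec c2 s2 s3 -> exec (Seq c1 c2) s1 s3
| ExecMatchNil i ce c0 c1 s s' :
    nth [::] s i = [::] -> exec ce s s' -> exec (Match i ce c0 c1) s s'
| ExecMatchCons i ce c0 c1 s s' b r :
    nth [::] s i = b :: r -> exec (if b then c1 else c0) (put s i r) s' ->
    exec (Match i ce c0 c1) s s'
| ExecLoopNil i c0 c1 s : nth [::] s i = [::] -> exec (Loop i c0 c1) s s
| ExecLoopCons i c0 c1 s1 s2 s3 b r :
    nth [::] s1 i = b :: r -> exec (if b then c1 else c0) (put s1 i r) s2 ->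
    exec (Loop i c0 c1) s2 s3 -> exec (Loop i c0 c1) s1 s3.

Definition cont : choiceType := seq {classic cmd}.

(** A continuation lists the commands still to run. Running [c] before [ks] meets only finitely
    many, since a loop body returns to the loop itself, so they can serve as control states. *)
Fixpoint conts (c : cmd) (ks : cont) : seq cont :=
  (c :: ks : cont) :: match c with
  | Seq c1 c2 => conts c1 (c2 :: ks) ++ conts c2 ks
  | Match _ ce c0 c1 => conts ce ks ++ conts c0 ks ++ conts c1 ks
  | Loop _ c0 c1 => conts c0 (c :: ks) ++ conts c1 (c :: ks)
  | _ => [::]
  end.

Section Compilation.

Variable prog : cmd.

Let S : seq cont := [::] :: conts prog [::].

Let nil_in_S : [::] \in S. Proof. exact: mem_head. Qed.

(** The default value is the halting continuation; by [at_contK] it never replaces a member of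
    [S]. *)
Definition at_cont (ks : cont) : seq_sub S := insubd (SeqSub nil_in_S) ks.

Definition keep (r : {ffun 'I_K -> symbol}) : {ffun 'I_K -> symbol * move} :=
  [ffun j => (r j, Stay)].

Definition act_on i (a : symbol * move) (r : {ffun 'I_K -> symbol}) :=
  [ffun j => if j == i then a else (r j, Stay)].

(* A push takes two steps: move left, then write. The first component of the
   state remembers the pending write. *)
Definition stack_delta (q : option ('I_K * bool) * seq_sub S)
    (r : {ffun 'I_K -> symbol}) :=
  let goto ks := (None : option ('I_K * bool), at_cont ks) in
  if q.1 is Some (i, b) then Some ((None, q.2), act_on i (Some b, Stay) r)
  else match val q.2 return option (_ * {ffun 'I_K -> symbol * move}) with
  | [::] => None
  | Nop :: ks => Some (goto ks, keep r)
  | Push i b :: ks => Some ((Some (i, b), at_cont ks), act_on i (r i, MoveLeft) r)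
  | Seq c1 c2 :: ks => Some (goto [:: c1, c2 & ks], keep r)
  | Match i ce c0 c1 :: ks =>
      if r i is Some b
      then Some (goto ((if b then c1 else c0) :: ks), act_on i (r i, MoveRight) r)
      else Some (goto (ce :: ks), keep r)
  | Loop i c0 c1 :: ks =>
      if r i is Some b
      then Some (goto [:: if b then c1 else c0, Loop i c0 c1 & ks],
                 act_on i (r i, MoveRight) r)
      else Some (goto ks, keep r)
  end.

Definition stack_machine : machine :=
  @Machine (option ('I_K * bool) * seq_sub S)%type extra
    (None, at_cont [:: prog]) stack_delta.

(** Cells left of the head are unconstrained: a pop leaves its symbol there and a later push
    overwrites it. The blank that ends a word stays in place under pushes. *)
Definition represents (T : {ffun 'I_K -> tape}) s :=
  forall i, tape_word (T i) = nth [::] s i.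

Definition at_config (ks : cont) (T : {ffun 'I_K -> tape}) : config stack_machine :=
  @Config stack_machine (None, at_cont ks) T.

Definition reaches (cf cf' : config stack_machine) :=
  exists m, iter m (@step stack_machine) cf = cf'.

Lemma reaches_trans cf1 cf2 cf3 :
  reaches cf1 cf2 -> reaches cf2 cf3 -> reaches cf1 cf3.
Proof. by move=> [m <-] [m' <-]; exists (m' + m); rewrite iterD. Qed.

Lemma at_contK ks : ks \in S -> val (at_cont ks) = ks.
Proof. by move=> h; rewrite /at_cont val_insubd h. Qed.

Lemma write_move_stay (t : tape) : write_move (scanned t, Stay) t = t.
Proof. by case: t. Qed.

Lemma keepE (T : {ffun 'I_K -> tape}) :
  [ffun i => write_move (keep [ffun j => scanned (T j)] i) (T i)] = T.
Proof. by apply/ffunP => i; rewrite !ffunE write_move_stay. Qed.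

Lemma act_onE i a (T : {ffun 'I_K -> tape}) :
  [ffun j => write_move (act_on i a [ffun j => scanned (T j)] j) (T j)] =
  [ffun j => if j == i then write_move a (T j) else T j].
Proof.
by apply/ffunP => j; rewrite !ffunE; case: (j == i) => //; rewrite write_move_stay.
Qed.

Lemma tape_word_pop (t : tape) b r : tape_word t = b :: r ->
  scanned t = Some b /\ tape_word (write_move (Some b, MoveRight) t) = r.
Proof.
by case: t => l [c|] rr //= [-> <-]; split => //; case: rr.
Qed.

Lemma tape_word_nil (t : tape) : tape_word t = [::] -> scanned t = None.
Proof. by case: t => l [c|]. Qed.

Lemma reaches_pop ks (T : {ffun 'I_K -> tape}) s i b r ks' :
  represents T s -> nth [::] s i = b :: r ->
  (scanned (T i) = Some b ->
   step (at_config ks T) = at_config ks' [ffun j => write_move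
     (act_on i (Some b, MoveRight) [ffun j => scanned (T j)] j) (T j)]) ->
  exists2 T', reaches (at_config ks T) (at_config ks' T') & represents T' (put s i r).
Proof.
move=> hT hs hstep; have [hb hw] : scanned (T i) = Some b /\
  tape_word (write_move (Some b, MoveRight) (T i)) = r.
  by apply: tape_word_pop; rewrite hT.
eexists; first by exists 1; rewrite /= hstep.
rewrite act_onE => j; rewrite ffunE nth_set_nth /= val_eqE.
by case: eqP => [->|_].
Qed.

(** Induction on the derivation, for every [ks] at once, because a loop runs its body with itself on
    top of the continuation. Besides its premises, each rule costs one machine step, and a push
    two. *)
Lemma exec_reaches c s s' : exec c s s' ->
  forall ks T, {subset conts c ks <= S} -> ks \in S -> represents T s ->
  exists2 T', reaches (at_config (c :: ks) T) (at_config ks T') & represents T' s'.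
Proof.
elim=> {c s s'}.
- move=> s ks T hc hk hT; exists T => //; exists 1.
  rewrite /= /step /next /= /stack_delta /= at_contK ?keepE //.
  by apply: hc; exact: mem_head.
- move=> i b s ks T hc hk hT; eexists.
    exists 2; rewrite /= {2}/step /next /= {1}/stack_delta /= at_contK; last first.
      by apply: hc; exact: mem_head.
    rewrite /step /next /= /stack_delta /= !act_onE; reflexivity.
  move=> j; rewrite !ffunE nth_set_nth /= val_eqE; case: eqP => [->|//].
  by rewrite -hT; case: (T i).
- move=> c1 c2 s1 s2 s3 _ IH1 _ IH2 ks T hc hk hT.
  have h0 : (Seq c1 c2 :: ks : cont) \in S by apply: hc; exact: mem_head.
  have h1 : {subset conts c1 (c2 :: ks) <= S}.
    by move=> l hl; apply: hc; rewrite /= inE mem_cat hl orbT.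
  have h2 : {subset conts c2 ks <= S}.
    by move=> l hl; apply: hc; rewrite /= inE mem_cat hl !orbT.
  have [|T1 r1 hT1] := IH1 (c2 :: ks) T h1 _ hT.
    by apply: h2; case: (c2) => *; exact: mem_head.
  have [T2 r2 hT2] := IH2 ks T1 h2 hk hT1.
  exists T2 => //; apply: reaches_trans r2; apply: reaches_trans r1; exists 1.
  by rewrite /= /step /next /= /stack_delta /= at_contK // keepE.
- move=> i ce c0 c1 s s' hs _ IH ks T hc hk hT.
  have h0 : (Match i ce c0 c1 :: ks : cont) \in S by apply: hc; exact: mem_head.
  have h1 : {subset conts ce ks <= S}.
    by move=> l hl; apply: hc; rewrite /= inE mem_cat hl orbT.
  have [T1 r1 hT1] := IH ks T h1 hk hT.
  exists T1 => //; apply: reaches_trans r1; exists 1.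
  rewrite /= /step /next /= /stack_delta /= at_contK // ffunE.
  by rewrite tape_word_nil ?hT // keepE.
- move=> i ce c0 c1 s s' b r hs _ IH ks T hc hk hT.
  have h0 : (Match i ce c0 c1 :: ks : cont) \in S by apply: hc; exact: mem_head.
  have h1 : {subset conts (if b then c1 else c0) ks <= S}.
    move=> l hl; apply: hc; rewrite /= inE !mem_cat.
    by case: b hl {IH hs} => ->; rewrite !orbT.
  have [|T1 r1 hT1] := @reaches_pop (Match i ce c0 c1 :: ks) T s i b r
    ((if b then c1 else c0) :: ks) hT hs.
    by move=> e; rewrite /= /step /next /= /stack_delta /= at_contK // ffunE e.
  have [T2 r2 hT2] := IH ks T1 h1 hk hT1.
  by exists T2 => //; apply: reaches_trans r2.
- move=> i c0 c1 s hs ks T hc hk hT.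
  have h0 : (Loop i c0 c1 :: ks : cont) \in S by apply: hc; exact: mem_head.
  exists T => //; exists 1.
  rewrite /= /step /next /= /stack_delta /= at_contK // ffunE.
  by rewrite tape_word_nil ?hT // keepE.
- move=> i c0 c1 s1 s2 s3 b r hs _ IH1 _ IH2 ks T hc hk hT.
  have h0 : (Loop i c0 c1 :: ks : cont) \in S by apply: hc; exact: mem_head.
  have h1 : {subset conts (if b then c1 else c0) (Loop i c0 c1 :: ks) <= S}.
    move=> l hl; apply: hc; rewrite /= inE !mem_cat.
    by case: b hl {IH1 hs} => ->; rewrite !orbT.
  have [|T1 r1 hT1] := @reaches_pop (Loop i c0 c1 :: ks) T s1 i b r
    [:: if b then c1 else c0, Loop i c0 c1 & ks] hT hs.
    by move=> e; rewrite /= /step /next /= /stack_delta /= at_contK // ffunE e.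
  have [T2 r2 hT2] := IH1 _ T1 h1 h0 hT1.
  have [T3 r3 hT3] := IH2 ks T2 hc hk hT2.
  by exists T3 => //; apply: reaches_trans r3; apply: reaches_trans r2.
Qed.

Lemma tape_word_of (u : bits) : tape_word (tape_of u) = u.
Proof.
case: u => //= b u; rewrite /tape_word /=; congr cons.
by elim: u => //= ? ? ->.
Qed.

Lemma exec_computes p q s :
  exec prog [:: p, q & nseq extra [::]] s -> computes stack_machine p q (head [::] s).
Proof.
move=> h; pose T := tapes (init stack_machine p q).
have hc : {subset conts prog [::] <= S} by move=> l hl; rewrite inE hl orbT.
have hT : represents T [:: p, q & nseq extra [::]].
  move=> i; rewrite ffunE tape_word_of; case: i => [[|[|i]] hi] //=.
  by rewrite nth_nseq; case: ifP.
have [T' [m em] hT'] := exec_reaches h hc nil_in_S hT.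
exists m; rewrite [init _ _ _](_ : _ = at_config [:: prog] T) // em.
split; last by rewrite /= hT' nth0.
by rewrite /halted /next /= /stack_delta /= at_contK.
Qed.

End Compilation.

Lemma nth_put s i v (j : 'I_K) :
  nth [::] (put s i v) j = if j == i then v else nth [::] s j.
Proof. by rewrite nth_set_nth /= val_eqE. Qed.

Lemma size_put s i v : size s = K -> size (put s i v) = K.
Proof. by move=> hs; rewrite size_set_nth hs; apply/maxn_idPr. Qed.

Lemma eq_store s s' : size s = K -> size s' = K ->
  (forall k : 'I_K, nth [::] s k = nth [::] s' k) -> s = s'.
Proof.
move=> hs hs' h; apply: (@eq_from_nth _ [::]); rewrite hs ?hs' // => k hk.
exact: (h (Ordinal hk)).
Qed.

(** A move reverses the word, so a table rebuilt bit by bit on another stack needs one move back to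
    regain its order. *)
Lemma exec_move i j s : i != j -> size s = K ->
  exec (Loop i (Push j false) (Push j true)) s
    (put (put s i [::]) j (rev (nth [::] s i) ++ nth [::] s j)).
Proof.
move=> ij; have [u eu] : exists u, nth [::] s i = u by eexists.
rewrite eu; elim: u s eu => [|b u IH] s eu hs.
  rewrite [put _ j _](_ : _ = s); first exact: ExecLoopNil.
  apply: eq_store; rewrite ?size_put // => k; rewrite !nth_put.
  by case: eqP => [->|_] //; case: eqP => [->|].
pose s1 := put (put s i u) j (b :: nth [::] s j).
have e1 : exec (if b then Push j true else Push j false) (put s i u) s1.
  rewrite [X in exec X](_ : _ = Push j b); last by case: (b).
  by have := ExecPush j b (put s i u); rewrite nth_put eq_sym (negbTE ij).
apply: ExecLoopCons eu e1 _.
rewrite [X in exec _ _ X](_ : _ = put (put s1 i [::]) j (rev u ++ nth [::] s1 j)).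
  by apply: IH; rewrite ?size_put // !nth_put (negbTE ij) eqxx.
apply: eq_store; rewrite ?size_put // => k; rewrite !nth_put eqxx.
by case: eqP => _ //; [rewrite rev_cons cat_rcons | case: eqP].
Qed.

End StackPrograms.

(** * The decoder *)

Arguments put _ _ _ _ /.
Arguments Nop {extra}.

Local Notation "c1 ;; c2" := (Seq c1 c2) (at level 60, right associativity).

(** [prg] holds the transcript followed by the index, [tblA] and [tblB] the current rectangle, [out]
    a counter that ends as the reversed output; [ctl] and [tmp] drive loops and hold intermediate
    words. *)
Local Notation prg := (@Ordinal 8 0 isT).
Local Notation dsc := (@Ordinal 8 1 isT).
Local Notation tblA := (@Ordinal 8 2 isT).
Local Notation tblB := (@Ordinal 8 3 isT).
Local Notation tmp := (@Ordinal 8 4 isT).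
Local Notation tblAB := (@Ordinal 8 5 isT).
Local Notation out := (@Ordinal 8 6 isT).
Local Notation ctl := (@Ordinal 8 7 isT).

Definition transfer (i j : 'I_8) : cmd 6 := Loop i (Push j false) (Push j true).
Definition pop (i : 'I_8) : cmd 6 := Match i Nop Nop Nop.
Definition clear (i : 'I_8) : cmd 6 := Loop i Nop Nop.
Definition repeat_for (i : 'I_8) (c : cmd 6) : cmd 6 := Loop i c c.

Ltac run := rewrite /=; lazymatch goal with
  | |- exec Nop _ _ => exact: ExecNop
  | |- exec (Push _ _) _ _ => exact: ExecPush
  | |- exec (Seq _ _) _ _ => first
      [apply: ExecSeq; [solve [run] | run] | apply: ExecSeq]
  | |- exec (Match _ _ _ _) _ _ => first
      [ apply: ExecMatchCons; [reflexivity | run]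
      | apply: ExecMatchNil; [reflexivity | run] ]
  | |- exec (pop _) _ _ => rewrite /pop; run
  | |- _ => idtac
  end.
Ltac loop_nil := apply: ExecLoopNil; reflexivity.
Ltac loop_cons := apply: ExecLoopCons; [reflexivity | |].

Lemma exec_transfer (i j : 'I_8) s s' : i != j -> size s = 8 ->
  s' = put (put s i [::]) j (rev (nth [::] s i) ++ nth [::] s j) ->
  exec (transfer i j) s s'.
Proof. by move=> ij hs ->; exact: exec_move. Qed.

Lemma exec_eq (c : cmd 6) s s1 s2 : exec c s s1 -> s1 = s2 -> exec c s s2.
Proof. by move=> h <-. Qed.

Lemma exec_if (b : bool) (c : cmd 6) s s' :
  exec c s s' -> exec (if b then c else c) s s'.
Proof. by case: b. Qed.

Ltac branch := first [apply: exec_if | rewrite /=].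

(** * Reading the input length *)

Definition read_length : cmd 6 :=
  repeat_for ctl (Match dsc Nop Nop
    (Push tblAB true ;; Push tblAB true ;; Push out true ;;
     repeat_for tblA (Push tmp true ;; Push tblB true) ;;
     repeat_for tmp (Push tblA true ;; Push tblA true) ;;
     Push ctl true)).

(** The tables for length 0 are doubled at each unary mark, which yields the full cube. [out]
    becomes [2n] zeros, a zero and [n] ones: the reversed pair code of two zero words, where
    counting will start. *)
Definition read_header : cmd 6 :=
  Push tblA true ;; Push tblB true ;; Push ctl true ;; read_length ;;
  Push out false ;; repeat_for tblAB (Push out false).

Lemma nseq_shift (T : Type) m (b : T) s : nseq m b ++ b :: s = b :: nseq m b ++ s.
Proof. by elim: m => //= m ->. Qed.

Lemma exec_read_length p m D l V w b :
  exec read_length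
    [:: p; nseq m true ++ false :: D; nseq l true; nseq l true; [::]; V; w; [:: b]]
    [:: p; D; nseq (2 ^ m * l) true; nseq (2 ^ m * l) true; [::];
        nseq (m + m) true ++ V; nseq m true ++ w; [::]].
Proof.
elim: m l V w b => [|m IH] l V w b.
  rewrite mul1n; loop_cons; last by loop_nil.
  by branch; run.
have double l1 l2 t : exec (repeat_for tblA (Push tmp true ;; Push tblB true))
    [:: p; nseq m true ++ false :: D; nseq l1 true; nseq l2 true; t; [:: true, true & V];
        true :: w; [::]]
    [:: p; nseq m true ++ false :: D; [::]; nseq (l1 + l2) true; nseq l1 true ++ t;
        [:: true, true & V]; true :: w; [::]].
  elim: l1 l2 t => [|l1 IHl] l2 t; first by loop_nil.
  loop_cons; first by branch; run.
  by apply: exec_eq (IHl l2.+1 _) _; rewrite addnS nseq_shift.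
have double' l1 l2 B : exec (repeat_for tmp (Push tblA true ;; Push tblA true))
    [:: p; nseq m true ++ false :: D; nseq l2 true; B; nseq l1 true; [:: true, true & V];
        true :: w; [::]]
    [:: p; nseq m true ++ false :: D; nseq (l1 + l1 + l2) true; B; [::];
        [:: true, true & V]; true :: w; [::]].
  elim: l1 l2 => [|l1 IHl] l2; first by loop_nil.
  loop_cons; first by branch; run.
  by apply: exec_eq (IHl l2.+2) _; rewrite addnS !addSn !addnS.
loop_cons.
  branch; run; first exact: double.
  by rewrite cats0; run; [exact: (double' l 0) | run].
rewrite /= addn0; apply: exec_eq (IH _ _ _ _) _.
by rewrite addnS /= expnS -mulnA (mulnCA 2) mul2n addnn !nseq_shift.
Qed.

Lemma exec_read_header p m D :
  exec read_header
    [:: p; nseq m true ++ false :: D; [::]; [::]; [::]; [::]; [::]; [::]]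
    [:: p; D; nseq (2 ^ m) true; nseq (2 ^ m) true; [::]; [::];
        nseq (m + m) false ++ false :: nseq m true; [::]].
Proof.
rewrite /read_header; run; first exact: (@exec_read_length p m D 1).
rewrite muln1 !cats0; run.
elim: (m + m) (false :: _) => [|k IH] w; first by loop_nil.
loop_cons; first by branch; run.
by apply: exec_eq (IH _) _; rewrite /= nseq_shift.
Qed.

(** * Restricting tables and skipping subtrees *)

Definition filter_table (i : 'I_8) (b : bool) : cmd 6 :=
  Loop i (pop dsc ;; Push tmp false)
         (Match dsc Nop (Push tmp (false == b)) (Push tmp (true == b))) ;;
  transfer tmp i.

Definition restrict (b : bool) (u t : bits) : bits :=
  [seq ub.1 && (ub.2 == b) | ub <- zip u t].

Lemma exec_filter_tblA p b t D u v T w k : size u = size t ->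
  exec (filter_table tblA b)
    [:: p; t ++ D; u; v; [::]; T; w; k] [:: p; D; restrict b u t; v; [::]; T; w; k].
Proof.
move=> ut; apply: (@ExecSeq _ _ _ _
  [:: p; D; [::]; v; rev (restrict b u t) ++ [::]; T; w; k]); last first.
  by apply: exec_transfer => //; rewrite /= !cats0 revK.
(* The accumulator on [tmp] is generalised at both ends of the run; the occurrence left alone is the
   exhausted table. *)
elim: u t {1 3}(@nil bool) ut => [|a u IH] [|c t] m //=; first by move=> _; loop_nil.
move=> [ut]; loop_cons; last first.
  by apply: exec_eq (IH _ ((a && (c == b)) :: m) ut) _; rewrite rev_cons cat_rcons.
by case: a; case: c; run.
Qed.

Lemma exec_filter_tblB p b t D u v T w k : size v = size t ->
  exec (filter_table tblB b)
    [:: p; t ++ D; u; v; [::]; T; w; k] [:: p; D; u; restrict b v t; [::]; T; w; k].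
Proof.
move=> ut; apply: (@ExecSeq _ _ _ _
  [:: p; D; u; [::]; rev (restrict b v t) ++ [::]; T; w; k]); last first.
  by apply: exec_transfer => //; rewrite /= !cats0 revK.
elim: v t {1 3}(@nil bool) ut => [|a v IH] [|c t] m //=; first by move=> _; loop_nil.
move=> [ut]; loop_cons; last first.
  by apply: exec_eq (IH _ ((a && (c == b)) :: m) ut) _; rewrite rev_cons cat_rcons.
by case: a; case: c; run.
Qed.

(* [tblA] is emptied and refilled only to count the [2 ^ n] entries of a table. *)
Definition skip_table : cmd 6 :=
  Loop tblA (pop dsc ;; Push tmp false) (pop dsc ;; Push tmp true) ;;
  transfer tmp tblA.

Definition skip_node : cmd 6 :=
  Match dsc Nop skip_table (pop dsc ;; skip_table ;; Push ctl true ;; Push ctl true).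

(* [ctl] holds one mark for each subtree that remains to be skipped. *)
Definition skip_tree : cmd 6 := Push ctl true ;; repeat_for ctl skip_node.

Lemma exec_skip_table p t D u v T w k : size u = size t ->
  exec skip_table [:: p; t ++ D; u; v; [::]; T; w; k] [:: p; D; u; v; [::]; T; w; k].
Proof.
move=> ut; apply: (@ExecSeq _ _ _ _ [:: p; D; [::]; v; rev u ++ [::]; T; w; k]); last first.
  by apply: exec_transfer => //; rewrite /= !cats0 revK.
elim: u t {1 3}(@nil bool) ut => [|a u IH] [|c t] m //=; first by move=> _; loop_nil.
move=> [ut]; loop_cons; last first.
  by apply: exec_eq (IH _ (a :: m) ut) _; rewrite rev_cons cat_rcons.
by case: a; case: c; run.
Qed.

Lemma size_truth_table n (f : n.-tuple bool -> bool) : size (truth_table f) = 2 ^ n.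
Proof. by elim: n f => //= n IH f; rewrite size_cat !IH expnS mul2n addnn. Qed.

Lemma exec_skip_tree p n (P : protocol n) D u v T w : size u = 2 ^ n ->
  exec skip_tree [:: p; tree_code P ++ D; u; v; [::]; T; w; [::]]
                 [:: p; D; u; v; [::]; T; w; [::]].
Proof.
move=> hu; apply: ExecSeq; first exact: ExecPush.
(* Generalised over the pending marks [k]: skipping one subtree consumes exactly one mark, so the
   induction hypotheses chain over the two children. *)
suff skip1 k b s' : exec (repeat_for ctl skip_node) [:: p; D; u; v; [::]; T; w; k] s' ->
    exec (repeat_for ctl skip_node)
      [:: p; tree_code P ++ D; u; v; [::]; T; w; b :: k] s'.
  by apply: skip1; loop_nil.
elim: P D k b s' => [g|a P0 IH0 P1 IH1|a P0 IH0 P1 IH1] D k b s' h.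
- loop_cons; last exact: h.
  by branch; rewrite /skip_node; run; apply: exec_skip_table; rewrite size_truth_table.
- loop_cons; last first.
    by apply: (IH0 (tree_code P1 ++ D) _ true); apply: (IH1 _ _ true); exact: h.
  branch; rewrite /skip_node /= -!catA; run.
    by apply: exec_skip_table; rewrite size_truth_table.
  by run.
- loop_cons; last first.
    by apply: (IH0 (tree_code P1 ++ D) _ true); apply: (IH1 _ _ true); exact: h.
  branch; rewrite /skip_node /= -!catA; run.
    by apply: exec_skip_table; rewrite size_truth_table.
  by run.
Qed.

(** * Following the transcript down the tree *)

Fixpoint transcript n (P : protocol n) (x y : n.-tuple bool) : bits :=
  match P with
  | AliceOutputs _ => [::]
  | AliceSends a P0 P1 => a x :: (if a x then transcript P1 x y else transcript P0 x y)
  | BobSends b P0 P1 => b y :: (if b y then transcript P1 x y else transcript P0 x y)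
  end.

Lemma size_transcript n (P : protocol n) x y : size (transcript P x y) = comm_cost P x y.
Proof. by elim: P => //= [a|b] P0 IH0 P1 IH1; case: ifP; rewrite ?IH0 ?IH1. Qed.

Fixpoint leaf_rectangle n (P : protocol n) (x y : n.-tuple bool)
    (A B : n.-tuple bool -> bool) :=
  match P with
  | AliceOutputs _ => (A, B)
  | AliceSends a P0 P1 =>
      leaf_rectangle (if a x then P1 else P0) x y (fun x' => A x' && (a x' == a x)) B
  | BobSends b P0 P1 =>
      leaf_rectangle (if b y then P1 else P0) x y A (fun y' => B y' && (b y' == b y))
  end.

(** On bit 0 the chosen subtree comes next in the code, and its sibling stays behind as an unread
    rest until the leaf clears [dsc]; on bit 1 the first subtree has to be skipped. *)
Definition walk_step (i : 'I_8) : cmd 6 :=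
  Match prg Nop (filter_table i false) (filter_table i true ;; skip_tree).

Definition walk : cmd 6 :=
  Loop dsc (clear dsc) (Match dsc Nop (walk_step tblA) (walk_step tblB)).

Lemma restrict_truth_table b n (A f : n.-tuple bool -> bool) :
  restrict b (truth_table A) (truth_table f) = truth_table (fun x => A x && (f x == b)).
Proof.
elim: n A f => //= n IH A f.
by rewrite /restrict zip_cat ?size_truth_table // map_cat -!/(restrict _ _ _) !IH.
Qed.

Lemma exec_clear_dsc p D u v t T w k :
  exec (clear dsc) [:: p; D; u; v; t; T; w; k] [:: p; [::]; u; v; t; T; w; k].
Proof.
elim: D => [|b D IH]; first by loop_nil.
by loop_cons; [branch; run | exact: IH].
Qed.

Lemma exec_walk n (P : protocol n) x y A B z D T w :
  let AB := leaf_rectangle P x y A B in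
  exec walk
    [:: transcript P x y ++ z; tree_code P ++ D; truth_table A; truth_table B;
        [::]; T; w; [::]]
    [:: z; [::]; truth_table AB.1; truth_table AB.2; [::]; T; w; [::]].
Proof.
elim: P A B D => [g|a P0 IH0 P1 IH1|b P0 IH0 P1 IH1] A B D /=.
- by loop_cons; [apply: exec_clear_dsc | loop_nil].
- rewrite -!catA; case e: (a x).
    loop_cons; last exact: IH1.
    rewrite /walk_step; run.
      by apply: exec_filter_tblA; rewrite !size_truth_table.
    by rewrite restrict_truth_table; apply: exec_skip_tree; rewrite size_truth_table.
  loop_cons; last exact: (IH0 _ _ (tree_code P1 ++ D)).
  rewrite /walk_step; run; rewrite -restrict_truth_table.
  by apply: exec_filter_tblA; rewrite !size_truth_table.
- rewrite -!catA; case e: (b y).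
    loop_cons; last exact: IH1.
    rewrite /walk_step; run.
      by apply: exec_filter_tblB; rewrite !size_truth_table.
    by rewrite restrict_truth_table; apply: exec_skip_tree; rewrite size_truth_table.
  loop_cons; last exact: (IH0 _ _ (tree_code P1 ++ D)).
  rewrite /walk_step; run; rewrite -restrict_truth_table.
  by apply: exec_filter_tblB; rewrite !size_truth_table.
Qed.

(** * The table of the rectangle *)

Definition product_row (a : bool) : cmd 6 :=
  transfer tblB ctl ;;
  Loop ctl (Push tblB false ;; Push tblAB false) (Push tblB true ;; Push tblAB a).

(** The transfers make both factors be traversed from their ends; as entries are pushed, the table
    comes out in lexicographic order. *)
Definition product_table : cmd 6 :=
  transfer tblA tmp ;; Loop tmp (product_row false) (product_row true).

Lemma exec_product_row p a D u v t T w :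
  exec (product_row a) [:: p; D; u; v; t; T; w; [::]]
    [:: p; D; u; v; t; [seq a && b | b <- v] ++ T; w; [::]].
Proof.
apply: (@ExecSeq _ _ _ _ [:: p; D; u; [::]; t; T; w; rev v]).
  by apply: exec_transfer => //; rewrite /= cats0.
have loop v0 v2 T' : exec
    (Loop ctl (Push tblB false ;; Push tblAB false) (Push tblB true ;; Push tblAB a))
    [:: p; D; u; v2; t; T'; w; v0]
    [:: p; D; u; rev v0 ++ v2; t; [seq a && b | b <- rev v0] ++ T'; w; [::]].
  elim: v0 v2 T' => [|b v0 IH] v2 T'; first by loop_nil.
  loop_cons; last first.
    apply: exec_eq (IH (b :: v2) ((a && b) :: T')) _.
    by rewrite rev_cons map_rcons !cat_rcons.
  by case: b; rewrite ?andbT ?andbF; run.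
by apply: exec_eq (loop _ _ _) _; rewrite revK cats0.
Qed.

Lemma exec_product_table p D u v w :
  exec product_table [:: p; D; u; v; [::]; [::]; w; [::]]
    [:: p; D; [::]; v; [::]; [seq a && b | a <- u, b <- v]; w; [::]].
Proof.
apply: (@ExecSeq _ _ _ _ [:: p; D; [::]; v; rev u; [::]; w; [::]]).
  by apply: exec_transfer => //; rewrite /= cats0.
have loop u0 T : exec (Loop tmp (product_row false) (product_row true))
   [:: p; D; [::]; v; u0; T; w; [::]]
   [:: p; D; [::]; v; [::]; [seq a && b | a <- rev u0, b <- v] ++ T; w; [::]].
  elim: u0 T => [|a u0 IH] T; first by loop_nil.
  loop_cons; last first.
    apply: exec_eq (IH ([seq a && b | b <- v] ++ T)) _.
    by rewrite rev_cons -cats1 allpairs_cat /= cats0 catA.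
  by case: a; exact: exec_product_row.
by apply: exec_eq (loop _ _) _; rewrite revK cats0.
Qed.

(* Numbers are stored least significant bit first; [None] is an overflow. *)
Fixpoint incr (s : bits) : option bits :=
  match s with
  | [::] => None
  | false :: r => Some (true :: r)
  | true :: r => omap (cons false) (incr r)
  end.

(** [tmp] holds a zero for each one that the carry has passed; these zeros are put back in front of
    the new one when the carry stops. *)
Definition increment_loop (i : 'I_8) : cmd 6 :=
  repeat_for ctl (Match i (clear tmp)
    (Push i true ;; repeat_for tmp (Push i false)) (Push tmp false ;; Push ctl true)).

(* On overflow the counter becomes empty, which stops [count_loop]. *)
Definition increment (i : 'I_8) : cmd 6 := Push ctl true ;; increment_loop i.

Lemma exec_increment_prg z D u v T w :
  exec (increment prg) [:: z; D; u; v; [::]; T; w; [::]]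
    [:: odflt [::] (incr z); D; u; v; [::]; T; w; [::]].
Proof.
apply: ExecSeq; first exact: ExecPush.
have loop m b : exec (increment_loop prg)
    [:: z; D; u; v; nseq m false; T; w; [:: b]]
    [:: oapp (cat (nseq m false)) [::] (incr z); D; u; v; [::]; T; w; [::]].
  elim: z m b => [|[] z IH] m b /=.
  - loop_cons; last by loop_nil.
    branch; run; elim: m => [|m IH]; first by loop_nil.
    by loop_cons; [run | exact: IH].
  - loop_cons; first by branch; run.
    apply: exec_eq (IH m.+1 true) _.
    by case: (incr z) => //= r; rewrite nseq_shift.
  - loop_cons; last by loop_nil.
    branch; run; elim: m (true :: z) => [|m IHm] z'; first by loop_nil.
    by loop_cons; [run | apply: exec_eq (IHm _) _; rewrite nseq_shift].
by apply: exec_eq (loop 0 true) _; case: (incr z).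
Qed.

Lemma exec_increment_out z D u v T w :
  exec (increment out) [:: z; D; u; v; [::]; T; w; [::]]
    [:: z; D; u; v; [::]; T; odflt [::] (incr w); [::]].
Proof.
apply: ExecSeq; first exact: ExecPush.
have loop m b : exec (increment_loop out)
    [:: z; D; u; v; nseq m false; T; w; [:: b]]
    [:: z; D; u; v; [::]; T; oapp (cat (nseq m false)) [::] (incr w); [::]].
  elim: w m b => [|[] w IH] m b /=.
  - loop_cons; last by loop_nil.
    branch; run; elim: m => [|m IH]; first by loop_nil.
    by loop_cons; [run | exact: IH].
  - loop_cons; first by branch; run.
    apply: exec_eq (IH m.+1 true) _.
    by case: (incr w) => //= r; rewrite nseq_shift.
  - loop_cons; last by loop_nil.
    branch; run; elim: m (true :: w) => [|m IHm] w'; first by loop_nil.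
    by loop_cons; [run | apply: exec_eq (IHm _) _; rewrite nseq_shift].
by apply: exec_eq (loop 0 true) _; case: (incr w).
Qed.

(** * Binary numbers of fixed width *)

Fixpoint nat_bits k v : bits :=
  if k is k'.+1 then odd v :: nat_bits k' v./2 else [::].

Fixpoint bin (s : bits) : nat := if s is b :: r then b + (bin r).*2 else 0.

Lemma incr_nat_bits k v : v.+1 < 2 ^ k -> incr (nat_bits k v) = Some (nat_bits k v.+1).
Proof.
elim: k v => [|k IH] v /=; first by rewrite ltnS ltn0.
rewrite expnS => hv; case e: (odd v) => /=.
  by rewrite IH /= ?uphalf_half ?e //; lia.
by rewrite uphalf_half e.
Qed.

Lemma incr_nat_bits_overflow k v : v.+1 = 2 ^ k -> incr (nat_bits k v) = None.
Proof.
elim: k v => [|k IH] v //=; rewrite expnS => hv.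
have -> : odd v by lia.
by rewrite IH //; lia.
Qed.

Lemma nat_bits_bin s : nat_bits (size s) (bin s) = s.
Proof.
elim: s => //= b s IH.
by rewrite oddD odd_double addbF half_bit_double oddb IH.
Qed.

Lemma size_nat_bits k v : size (nat_bits k v) = k.
Proof. by elim: k v => //= k IH v; rewrite IH. Qed.

Lemma bin_lt s : bin s < 2 ^ size s.
Proof. by elim: s => //= -[] s IH; rewrite expnS; lia. Qed.

Lemma bin_cat s t : bin (s ++ t) = bin s + 2 ^ size s * bin t.
Proof. by elim: s => [|b s IH] /=; rewrite ?mul1n // IH expnS; lia. Qed.

Lemma bin_nseq0 k : bin (nseq k false) = 0.
Proof. by elim: k => //= k ->. Qed.

(** [out] advances unless [prg] has overflowed, hence it counts the entries strictly before the one
    sought. The second [Match] only tests [prg] for emptiness and restores the popped bit. *)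
Definition count_step : cmd 6 :=
  Match tblAB Nop Nop (increment prg) ;;
  Match prg Nop (Push prg false ;; increment out) (Push prg true ;; increment out).

Lemma exec_count_step z D u v t T w :
  let z' := if t then odflt [::] (incr z) else z in
  exec count_step [:: z; D; u; v; [::]; t :: T; w; [::]]
    [:: z'; D; u; v; [::]; T; if z' is [::] then w else odflt [::] (incr w); [::]].
Proof.
move=> z'; apply: (@ExecSeq _ _ _ _ [:: z'; D; u; v; [::]; T; w; [::]]).
  apply: ExecMatchCons; first by [].
  by rewrite /z'; case: (t); [exact: exec_increment_prg | run].
case: z' => [|b z']; first by run.
by case: b; run; exact: exec_increment_out.
Qed.

Definition count_loop : cmd 6 :=
  Loop prg (Push prg false ;; count_step) (Push prg true ;; count_step).

(** By the equation for [v], the true entries of [T1] bring [prg] to its maximum and the next true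
    entry overflows it. For [n = 0] the word in [prg] would be empty and the loop would not
    start. *)
Lemma exec_count_loop n m v q D a b T1 T2 :
  0 < n -> (v + count id T1).+1 = 2 ^ n -> q + size T1 < 2 ^ m ->
  exists T, exec count_loop
    [:: nat_bits n v; D; a; b; [::]; T1 ++ true :: T2; nat_bits m q; [::]]
    [:: [::]; D; a; b; [::]; T; nat_bits m (q + size T1); [::]].
Proof.
case: n => // n _.
have step b0 r t T w s : let z' := if t then odflt [::] (incr (b0 :: r)) else b0 :: r in
    exec count_loop [:: z'; D; a; b; [::]; T;
      if z' is [::] then w else odflt [::] (incr w); [::]] s ->
    exec count_loop [:: b0 :: r; D; a; b; [::]; t :: T; w; [::]] s.
  move=> z' h; apply: ExecLoopCons h; first by [].
  by case: (b0) @z'; run; exact: exec_count_step.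
elim: T1 v q => [|t T1 IH] v q.
  rewrite /= !addn0 => hv _; exists T2.
  apply: step; rewrite -[odd v :: _]/(nat_bits n.+1 v).
  by rewrite incr_nat_bits_overflow //; loop_nil.
rewrite [count _ _]/= [size _]/= => hv hq.
have [|| T hT] := IH (v + t) q.+1; [lia | lia |].
exists T; rewrite addnS -addSn; apply: step.
rewrite -[odd v :: _]/(nat_bits n.+1 v) (incr_nat_bits (k := m)); last lia.
by case: t hv hT => hv; rewrite ?incr_nat_bits ?addn0 ?addn1 //; lia.
Qed.

(** Lexicographic order takes the first bit as most significant, [bin] as least significant; hence
    the [rev]. *)
Lemma truth_table_split n (f : n.-tuple bool -> bool) (x : n.-tuple bool) :
  exists t1 t2, truth_table f = t1 ++ f x :: t2 /\ size t1 = bin (rev x).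
Proof.
elim: n f x => [|n IH] f x; first by exists [::], [::]; rewrite (tuple0 x).
case/tupleP: x => b x; have sx : size (rev x) = n by rewrite size_rev size_tuple.
rewrite /= rev_cons -cats1 bin_cat sx /=.
have [t1 [t2 [et st]]] := IH (fun t => f (cons_tuple b t)) x.
case: b et => et /=; rewrite et.
  exists (truth_table (fun t => f (cons_tuple false t)) ++ t1), t2.
  by rewrite -catA size_cat st size_truth_table muln1 addnC.
exists t1, (t2 ++ truth_table (fun t => f (cons_tuple true t))).
by rewrite -catA muln0 addn0.
Qed.

Lemma sum_tupleS n (F : n.+1.-tuple bool -> nat) :
  \sum_t F t = \sum_(t : n.-tuple bool) F (cons_tuple false t) +
               \sum_(t : n.-tuple bool) F (cons_tuple true t).
Proof.
rewrite (reindex (fun p : bool * n.-tuple bool => cons_tuple p.1 p.2)) /=.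
  rewrite -(pair_big xpredT xpredT (fun b t => F (cons_tuple b t))) /=.
  by rewrite big_bool addnC.
exists (fun t => (thead t, behead_tuple t)) => [[b t] _|t _] /=.
  by congr pair; apply: val_inj.
by case/tupleP: t => b t; apply: val_inj.
Qed.

Lemma count_truth_table n (f : n.-tuple bool -> bool) :
  count id (truth_table f) = \sum_t f t.
Proof.
elim: n f => [|n IH] f; last by rewrite /= count_cat !IH sum_tupleS.
rewrite (bigD1 [tuple]) //= big1 // => t /eqP[]; exact: tuple0.
Qed.

Lemma count_product (u v : bits) :
  count id [seq a && b | a <- u, b <- v] = count id u * count id v.
Proof.
elim: u => //= a u IH; rewrite count_cat IH mulnDl; congr addn.
rewrite count_map; case: a => /=; first by rewrite mul1n; apply: eq_count => -[].
by rewrite mul0n; exact: count_pred0.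
Qed.

(** * Leaves are small rectangles *)

Section Parseval.
Import GRing.Theory Num.Theory.
Local Open Scope ring_scope.

Definition dot n (x y : n.-tuple bool) : nat := (\sum_(i < n) tnth x i * tnth y i)%N.

Definition chi n (x y : n.-tuple bool) : int := (-1) ^+ dot x y.

(** The sum over the cube factors into a product over coordinates with factors
    [1 + (-1) ^ (y_i + z_i)]; a coordinate where [y] and [z] differ contributes 0. *)
Lemma chi_orthogonal n (y z : n.-tuple bool) :
  \sum_x chi x y * chi x z = if y == z then (2 ^ n)%:R else 0.
Proof.
transitivity (\sum_(x : n.-tuple bool) \prod_(i < n)
  ((-1) ^+ (tnth x i * (tnth y i + tnth z i)) : int)).
  apply: eq_bigr => x _; rewrite /chi /dot -exprD -big_split /= prodrXr.
  by congr (_ ^+ _); apply: eq_bigr => i _; rewrite mulnDr.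
transitivity (\prod_(i < n) \sum_(b : bool) ((-1) ^+ (b * (tnth y i + tnth z i)) : int)).
  rewrite bigA_distr_bigA /=.
  rewrite (reindex (fun f : {ffun 'I_n -> bool} => [tuple f i | i < n])) /=.
    by apply: eq_bigr => f _; apply: eq_bigr => i _; rewrite tnth_mktuple.
  exists (fun x => [ffun i => tnth x i]) => [f|x] _.
    by apply/ffunP => i; rewrite ffunE tnth_mktuple.
  by apply: eq_from_tnth => i; rewrite tnth_mktuple ffunE.
case: eqP => [->|/eqP yz].
  rewrite (eq_bigr (fun=> 2)) ?prodr_const ?card_ord ?natrX // => i _.
  by rewrite big_bool; case: (tnth z i).
have [i hi] : exists i, tnth y i != tnth z i.
  apply/existsP; apply: contraNT yz => /existsPn h.
  by apply/eqP/eq_from_tnth => i; apply/eqP; have := h i; rewrite negbK.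
rewrite (bigD1 i) //= [X in X * _](_ : _ = 0) ?mul0r // big_bool.
by move: hi; case: (tnth y i); case: (tnth z i).
Qed.

(* Parseval: the squares of [\sum_(y | B y) chi x y] sum over all [x] to
   [2 ^ n * |B|], and each [x] in [A] contributes [|B| ^ 2]. *)
Lemma rectangle_bound n (A B g : n.-tuple bool -> bool) :
  (forall x y, A x -> B y -> odd (dot x y) = g x) ->
  ((\sum_x A x) * (\sum_y B y) <= 2 ^ n)%N.
Proof.
move=> h; set b := (\sum_y B y)%N.
(* An empty [B] is split off because a factor [b] is cancelled below. *)
have [->|b0] := posnP b; first by rewrite muln0.
have bE : b%:R = \sum_(y | B y) (1 : int).
  by rewrite /b natr_sum [RHS]big_mkcond; apply: eq_bigr => y _; case: (B y).
have parseval : \sum_x (\sum_(y | B y) chi x y) ^+ 2 = (2 ^ n * b)%:R.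
  (* After expanding the square and exchanging sums, orthogonality keeps only the diagonal
     [z = y]. *)
  under eq_bigr do rewrite expr2 mulr_suml.
  rewrite exchange_big /= natrM bE mulr_sumr; apply: eq_bigr => y By.
  under eq_bigr do rewrite mulr_sumr.
  rewrite exchange_big /=; under eq_bigr do rewrite chi_orthogonal.
  rewrite -big_mkcondr (big_pred1 y) ?mulr1 // => z /=; rewrite eq_sym.
  by case: eqP => [->|]; rewrite ?By ?andbF.
(* Times [b], the claim is compared with the Parseval sum term by term in [x]; outside [A] the terms
   are squares, hence nonnegative. *)
rewrite -(leq_pmul2r b0) -mulnA -(ler_nat int) -parseval natrM natr_sum mulr_suml.
apply: ler_sum => x _; case Ax: (A x); last by rewrite mul0r sqr_ge0.
(* On the rectangle the sign [chi x y] does not depend on [y], so the inner sum is [b] up to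
   sign. *)
rewrite mul1r (eq_bigr (fun=> (-1) ^+ g x * 1)); last first.
  by move=> y By; rewrite mulr1 /chi -signr_odd (h _ _ Ax By).
by rewrite -mulr_sumr -bE exprMn sqrr_sign mul1r natrM expr2.
Qed.

End Parseval.

(** * Rectangles of protocol leaves *)

Lemma leaf_rectangle_point n (P : protocol n) x y (A B : n.-tuple bool -> bool) :
  A x -> B y ->
  (leaf_rectangle P x y A B).1 x /\ (leaf_rectangle P x y A B).2 y.
Proof.
elim: P A B => //= [a|b] P0 IH0 P1 IH1 A B Ax By.
  by case e: (a x); [apply: IH1 | apply: IH0]; rewrite ?Ax ?e.
by case e: (b y); [apply: IH1 | apply: IH0]; rewrite ?By ?e.
Qed.

(** Going down the tree only adds constraints. Hence every point of the final rectangle answers the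
    queries on the path as [(x, y)] does. *)
Lemma leaf_rectangle_sub n (P : protocol n) x y (A B : n.-tuple bool -> bool) x' y' :
  ((leaf_rectangle P x y A B).1 x' -> A x') /\ ((leaf_rectangle P x y A B).2 y' -> B y').
Proof.
elim: P A B => //= [a|b] P0 IH0 P1 IH1 A B.
  set A' := fun _ => _ && _; set Q := if a x then _ else _.
  have [hA hB] : ((leaf_rectangle Q x y A' B).1 x' -> A' x') /\
      ((leaf_rectangle Q x y A' B).2 y' -> B y').
    by rewrite /Q; case: (a x).
  by split => [/hA /andP[]|/hB].
set B' := fun _ => _ && _; set Q := if b y then _ else _.
have [hA hB] : ((leaf_rectangle Q x y A B').1 x' -> A x') /\
    ((leaf_rectangle Q x y A B').2 y' -> B' y').
  by rewrite /Q; case: (b y).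
by split => [/hA|/hB /andP[]].
Qed.

Lemma leaf_rectangle_output n (P : protocol n) x y (A B : n.-tuple bool -> bool) :
  exists g, forall x' y', (leaf_rectangle P x y A B).1 x' ->
    (leaf_rectangle P x y A B).2 y' -> output P x' y' = g x'.
Proof.
elim: P A B => [g|a P0 IH0 P1 IH1|b P0 IH0 P1 IH1] A B /=; first by exists g.
- set A' := fun _ => _ && _; case e: (a x).
    have [g hg] := IH1 A' B; exists g => x' y' h1 h2.
    have [/(_ h1) /andP[_ /eqP ->] _] := leaf_rectangle_sub P1 x y A' B x' y'.
    by rewrite e; apply: hg.
  have [g hg] := IH0 A' B; exists g => x' y' h1 h2.
  have [/(_ h1) /andP[_ /eqP ->] _] := leaf_rectangle_sub P0 x y A' B x' y'.
  by rewrite e; apply: hg.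
- set B' := fun _ => _ && _; case e: (b y).
    have [g hg] := IH1 A B'; exists g => x' y' h1 h2.
    have [_ /(_ h2) /andP[_ /eqP ->]] := leaf_rectangle_sub P1 x y A B' x' y'.
    by rewrite e; apply: hg.
  have [g hg] := IH0 A B'; exists g => x' y' h1 h2.
  have [_ /(_ h2) /andP[_ /eqP ->]] := leaf_rectangle_sub P0 x y A B' x' y'.
  by rewrite e; apply: hg.
Qed.

(** * Assembling the decoder *)

Definition decoder : cmd 6 :=
  read_header ;; walk ;; product_table ;; count_loop ;; transfer out prg.

Lemma output_of_program n (P : protocol n) (x y : n.-tuple bool) :
  computes_inner_product P ->
  exists z, size z = n /\ exists s,
    exec decoder [:: transcript P x y ++ z, description P & nseq 6 [::]]
      (pair_code x y :: s).
Proof.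
move=> ip; pose AB := leaf_rectangle P x y xpredT xpredT.
have [Ax By] : AB.1 x /\ AB.2 y by exact: leaf_rectangle_point.
have [g hg] := leaf_rectangle_output P x y xpredT xpredT.
have bound : (\sum_x' AB.1 x') * (\sum_y' AB.2 y') <= 2 ^ n.
  apply: (@rectangle_bound _ _ _ g) => x' y' Ax' By'.
  have := ip x' y'; rewrite (hg _ _ Ax' By') modn2 => /(f_equal odd).
  by rewrite !oddb.
pose tA := truth_table AB.1; pose tB := truth_table AB.2.
have [a1 [a2 [eA sa]]] := truth_table_split AB.1 x.
have [b1 [b2 [eB sb]]] := truth_table_split AB.2 y.
pose T := [seq a && b | a <- tA, b <- tB].
(* The entries before the pair [(x, y)]: the rows before [x], then the start of row [x], which is
   [tB] because [AB.1 x] holds. *)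
pose T1 := [seq a && b | a <- a1, b <- tB] ++ b1.
pose T2 := b2 ++ [seq a && b | a <- a2, b <- tB].
have eT : T = T1 ++ true :: T2.
  rewrite /T {1}/tA eA allpairs_cat /= Ax {2}/tB eB map_cat /= By.
  by rewrite /T1 /T2 -!catA /= !map_id.
(* The pair itself lies in the rectangle, so its rank there is below [2 ^ n] and fits in [n]
   bits. *)
have cT : (count id T1).+1 <= 2 ^ n.
  apply: leq_trans bound; rewrite -!count_truth_table -count_product -/T eT.
  by rewrite count_cat /= add1n addnS ltnS leq_addr.
have sT1 : size T1 = bin (rev y) + 2 ^ n * bin (rev x).
  by rewrite /T1 size_cat size_allpairs size_truth_table sa sb addnC mulnC.
pose w0 := nseq (n + n) false ++ false :: nseq n true.
have code : rev (pair_code x y) = rev y ++ rev x ++ false :: nseq n true.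
  rewrite /pair_code rev_cat rev_cons rev_cat rev_nseq size_tuple.
  by rewrite -cats1 -!catA.
(* Both words end in the same zero and [n] ones, so the two numbers differ by the position of the
   pair. *)
have bin_code : bin (rev (pair_code x y)) = bin w0 + size T1.
  rewrite code /w0 !bin_cat bin_nseq0 size_nseq !size_rev !size_tuple sT1 expnD; lia.
have size_code : size (rev (pair_code x y)) = size w0.
  by rewrite code /w0 !size_cat !size_rev !size_tuple addnA.
(* The complement of the rank is stored, so that the counter overflows exactly at the pair. *)
pose v := (2 ^ n - 1 - count id T1)%N.
exists (nat_bits n v); split; first exact: size_nat_bits.
have [Tf hf] : exists Tf, exec count_loop
    [:: nat_bits n v; [::]; [::]; tB; [::]; T; w0; [::]]
    [:: [::]; [::]; [::]; tB; [::]; Tf; rev (pair_code x y); [::]].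
  (* For [n = 0] the index is empty and the loop does not run; the initial counter is already the
     answer. *)
  have [n0|n0] := posnP n.
    have e1 : 2 ^ n = 1 by rewrite n0.
    have := bin_lt (rev x); have := bin_lt (rev y).
    rewrite !size_rev !size_tuple e1 !ltnS !leqn0 => /eqP by0 /eqP bx0.
    rewrite by0 bx0 in sT1; exists T.
    rewrite -[rev _]nat_bits_bin size_code bin_code sT1 muln0 !addn0 nat_bits_bin.
    by rewrite [nat_bits n v](_ : _ = [::]) ?n0 //; loop_nil.
  rewrite eT -(nat_bits_bin (rev _)) size_code bin_code -{1}(nat_bits_bin w0).
  apply: exec_count_loop => //; first by rewrite /v; lia.
  by rewrite -bin_code -size_code; exact: bin_lt.
exists [:: [::]; [::]; tB; [::]; Tf; [::]; [::]].
apply: ExecSeq; first exact: exec_read_header.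
have ones m (F : m.-tuple bool -> bool) : F =1 xpredT -> nseq (2 ^ m) true = truth_table F.
  elim: m F => [|m IH] F hF /=; first by rewrite hF.
  rewrite -!IH => [|t|t]; rewrite ?hF //.
  by rewrite expnS mul2n -addnn nseqD.
rewrite (ones n xpredT) //; apply: ExecSeq.
  by rewrite -[tree_code P]cats0; exact: exec_walk.
apply: ExecSeq; first exact: exec_product_table.
apply: ExecSeq; first exact: hf.
(* The last transfer turns the counter, least significant bit first, into the pair code. *)
by apply: exec_transfer => //; rewrite /= revK cats0.
Qed.

Theorem theorem1 (U : universal_machine) :
  exists c : nat, forall (n : nat) (P : protocol n),
    computes_inner_product P ->
    forall x y : n.-tuple bool,
      comm_cost P x y >= complexity U (pair_code x y) (description P) - n - c.
Proof.
(* The constant is the length of the code of the decoder for [U], chosen before [n] and [P]. *)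
have [w wP] := umachineP U (stack_machine decoder).
exists (size w) => n P ip x y.
have [z [sz [s hs]]] := output_of_program x y ip.
have hc := exec_computes hs.
(* Transcript and index need no delimiter: the protocol tree tells the walk where the transcript
   ends. *)
have : complexity U (pair_code x y) (description P) <= size (w ++ transcript P x y ++ z).
  rewrite /complexity; case: ex_minnP => k _; apply.
  by apply/asboolP; eexists; split; [reflexivity | apply/wP].
by rewrite !size_cat size_transcript sz; lia.
Qed.
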